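(* Let $\boldsymbol{U}=(U_t)_{t\in[0,1]}$ be a copula process with sample paths in $C[0,1]$, let $\boldsymbol{Q}=(Q_t)_{t\in[0,1]}$ be a generalized Pareto copula process (constructed as in the context) with generator process $\boldsymbol{Z}=(Z_t)_{t\in[0,1]}$ having sample paths in $C[0,1]$, let $\boldsymbol{Q}$ be independent of $\boldsymbol{U}$ and let $\boldsymbol{Z}$ be independent of $\boldsymbol{U}$. Choose a threshold $u\in(0,1)$ and put $$Y_t:=U_t\,\mathbf{1}(U_t\le u)+\{u+(1-u)Q_t\}\,\mathbf{1}(U_t>u),\qquad t\in[0,1].$$ Then the process $\boldsymbol{Y}=(Y_t)_{t\in[0,1]}$ is a generalized Pareto copula process (GPCP) which is continuous in probability, with $D$-norm given by $$\|f\|_D=\mathrm{E}\left[\sup_{t\in[0,1]}\left\{|f(t)|\,Z_t\,\frac{\mathbf{1}(U_t>u)}{1-u}\right\}\right],\qquad f\in E[0,1].$$ That is, each $Y_t$ is uniformly distributed on $(0,1)$; for each $t\in[0,1]$ and $\varepsilon>0$, $\mathrm{P}(|Y_{t_n}-Y_t|>\varepsilon)\to0$ whenever $t_n\to t$; and there exists $\varepsilon_0>0$ such that for all $f\in\bar E^-[0,1]$ with $\|f\|_\infty\le\varepsilon_0$ $$\mathrm{P}\{Y_t\le 1+f(t),\ t\in[0,1]\}=1-\|f\|_D.$$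
   Context: $C[0,1]$ is the space of continuous functions on $[0,1]$. $E[0,1]$ is the set of bounded functions $f:[0,1]\to\mathbb{R}$ having only a finite number of discontinuities, and $\bar E^-[0,1]:=\{f\in E[0,1]: f\le 0\}$. $\|\cdot\|_\infty$ is the sup-norm; $\mathbf{1}(A)$ is the indicator of the event $A$. A copula process is a stochastic process $\boldsymbol{U}=(U_t)_{t\in[0,1]}$ such that each $U_t$ is uniformly distributed on $(0,1)$. A generator process is a process $\boldsymbol{Z}=(Z_t)_{t\in[0,1]}$ with $0\le Z_t\le c$ and $\mathrm{E}(Z_t)=1$ for all $t\in[0,1]$, for some constant $c\ge1$. Standard generalized Pareto process: let $\boldsymbol{Z}$ be a generator process with continuous sample paths and bound $c$, let $S$ be a random variable uniformly distributed on $(0,1)$ and independent of $\boldsymbol{Z}$, and let $M<0$ be a constant. Put $V_t:=\max(M,-S/Z_t)$, $0\le t\le1$ (with $V_t=M$ if $Z_t=0$). With $K:=\max(M,-1/c)$ one has $\mathrm{P}(V_t\le f(t),\,t\in[0,1])=1-\mathrm{E}\{\sup_{t\in[0,1]}(|f(t)|Z_t)\}$ for $f\in\bar E^-[0,1]$ with $\|f\|_\infty\le|K|$. Construction of the GPCP $\boldsymbol{Q}$ with generator $\boldsymbol{Z}$: assume $K>-1$, let $\xi$ be uniformly distributed on $(-1,K)$ and independent of $\boldsymbol{V}=(V_t)_{t\in[0,1]}$, put $\widetilde V_t:=V_t$ if $V_t>K$ and $\widetilde V_t:=\xi$ if $V_t\le K$, and set $Q_t:=\widetilde V_t+1$, $t\in[0,1]$.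 In general, a generalized Pareto copula process (GPCP) with $D$-norm $\|\cdot\|_D$ is a copula process $\boldsymbol{Y}$ such that $(Y_t-1)_{t\in[0,1]}$ is a generalized Pareto process, meaning here that $\mathrm{P}\{Y_t-1\le f(t),\,t\in[0,1]\}=1-\|f\|_D$ for all $f\in\bar E^-[0,1]$ with sufficiently small sup-norm, where $\|f\|_D=\mathrm{E}\{\sup_{t\in[0,1]}(|f(t)|\widetilde Z_t)\}$ for some generator process $\widetilde{\boldsymbol{Z}}$ (not necessarily with continuous paths). *)

(* Defs.v *)
From HB Require Import structures.
From mathcomp Require Import all_boot all_order all_algebra.
From mathcomp Require Import all_classical all_reals all_analysis.

Set Implicit Arguments.
Unset Strict Implicit.
Unset Printing Implicit Defensive.

Import Order.TTheory GRing.Theory Num.Theory.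
Import numFieldTopology.Exports numFieldNormedType.Exports.

Local Open Scope classical_set_scope.
Local Open Scope ring_scope.

Definition I01 {R : realType} : set R := `[0, 1]%classic.

(* A function on [0,1] is represented by some f : R -> R, and a process
   (X_t), t in [0,1], on a space T by some X : R -> T -> R; values at indices
   outside [0,1] are irrelevant and never inspected. *)

Section FunctionSpaces.
Context {R : realType}.
Implicit Type f : R -> R.

Definition sup_norm f : R := sup [set `|f t| | t in I01].

(* Continuity is relative to [0,1], hence one-sided at the endpoints. *)
Definition discontinuities f : set R :=
  [set t | I01 t /\ ~ (f s @[s --> within I01 (nbhs t)] --> f t)].

Definition bounded_on01 f : Prop := exists C, forall t, I01 t -> `|f t| <= C.

Definition E01 f : Prop := bounded_on01 f /\ finite_set (discontinuities f).

Definition E01_neg f : Prop := E01 f /\ forall t, I01 t -> f t <= 0.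

End FunctionSpaces.

Section Processes.
Context {R : realType} {d : measure_display} {T : measurableType d}.
Variable P : probability T R.
Implicit Types (X Y Z : R -> T -> R) (N : (R -> R) -> \bar R).

Definition uniform_rv (a b : R) (ab : a < b) (X : T -> R) : Prop :=
  measurable_fun setT X /\
  forall A : set R, measurable A -> pushforward P X A = uniform_prob ab A.

Definition sigma_of (F : set (T -> R)) : set (set T) :=
  <<s \bigcup_(X in F) preimage_set_system setT X (measurable : set (set R)) >>.

Definition sigma_rv (X : T -> R) : set (set T) := sigma_of [set X].

Definition sigma_process X : set (set T) := sigma_of [set X t | t in I01].

Definition independent (F G : set (set T)) : Prop :=
  forall A B, F A -> G B -> P (A `&` B) = (P A * P B)%E.

(* The event A belongs to the P-completion of the sigma-algebra and has
   (completed) probability p. An event involving all t in [0,1] at once need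
   not lie in the sigma-algebra itself: the uniform variables below are only
   specified by their law, so on a null set they are arbitrary. *)
Definition has_probability (A : set T) (p : \bar R) : Prop :=
  exists B, [/\ measurable B, P.-negligible (A `+` B) & P B = p].

Definition continuous_paths X : Prop :=
  forall w, {within I01, continuous (fun t => X t w)}.

Definition copula_process X : Prop :=
  forall t, I01 t -> uniform_rv ltr01 (X t).

Definition generator_process (c : R) Z : Prop :=
  1 <= c /\
  forall t, I01 t -> [/\ measurable_fun setT (Z t),
    forall w, 0 <= Z t w <= c & ('E_P[Z t] = 1)%E].

Definition weighted_sup Z (f : R -> R) (w : T) : R :=
  sup [set `|f t| * Z t w | t in I01].

Definition generated_norm Z (f : R -> R) : \bar R :=
  'E_P[weighted_sup Z f]%E.

Definition continuous_in_probability X : Prop :=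
  forall (t : R) (s : nat -> R) (e : R), I01 t -> (forall n, I01 (s n)) ->
    s @ \oo --> t -> 0 < e ->
    P [set w | e < `|X (s n) w - X t w|] @[n --> \oo] --> 0%E.

End Processes.

(* The generator of a D-norm may live on any probability space. The suprema
   are required to be random variables: their expectation would otherwise be
   meaningless, as paths need not be continuous. *)
Definition is_Dnorm {R : realType} (N : (R -> R) -> \bar R) : Prop :=
  exists (d : measure_display) (T : measurableType d) (P : probability T R)
    (c : R) (Z : R -> T -> R),
    generator_process P c Z /\
    forall f, E01 f ->
      measurable_fun setT (weighted_sup Z f) /\ N f = generated_norm P Z f.

Definition GPCP {R : realType} {d : measure_display} {T : measurableType d}
    (P : probability T R) (N : (R -> R) -> \bar R) (Y : R -> T -> R) : Prop :=
  [/\ copula_process P Y, is_Dnorm N &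
    exists2 e0 : R, 0 < e0 & forall f, E01_neg f -> sup_norm f <= e0 ->
      has_probability P [set w | forall t, I01 t -> Y t w <= 1 + f t]
        (1 - N f)%E].

Section Construction.
Context {R : realType} {T : Type}.
Implicit Types (Z U Q : R -> T -> R) (S xi : T -> R).

Definition K_const (c M : R) : R := Num.max M (- c^-1).

Definition V_process (M : R) S Z (t : R) (w : T) : R :=
  if Z t w == 0 then M else Num.max M (- S w / Z t w).

Definition Q_process (c M : R) S xi Z (t : R) (w : T) : R :=
  let v := V_process M S Z t w in
  (if K_const c M < v then v else xi w) + 1.

Definition Y_process (u : R) U Q (t : R) (w : T) : R :=
  U t w * (U t w <= u)%R%:R
  + (u + (1 - u) * Q t w) * (u < U t w)%R%:R.

End Construction.

(* Main.v *)
Require Import Defs.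
From HB Require Import structures.
From mathcomp Require Import all_boot all_order all_algebra.
From mathcomp Require Import all_classical all_reals all_analysis.
From mathcomp Require Import measurable_realfun ring lra.

(** Why the theorem holds.  Write [K = K_const c M].  Off a null set, and for
    [0 <= theta <= - K], the event [1 - theta < Q_t] is [S < theta * Z_t]
    ([Q_process_gt]): the values that [Q] borrows from [xi] all lie below the
    level [1 + K] and cannot be seen from above it.  For small [f <= 0] the
    process [Y] therefore rises above [1 + f] at [t] exactly when [U_t > u] and
    [S < |f t| / (1 - u) * Z_t], that is, when [S < |f t| * Z'_t] for the
    thinned generator [Z'_t = Z_t * 1(U_t > u) / (1 - u)].  So [Y] exceeds [1 + f]
    somewhere iff [S] lies below the supremum of [|f| Z'], and the claim is that
    this has probability [E sup |f| Z'].

    If [S] were independent of the pair [(Z, U)], this would follow at once from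
    the uniformity of [S].  The hypotheses only say that [S] is independent of
    [Z], [Q] of [U], and [Z] of [U], and the proof passes through all three.
    Fubini for [(Q, U)] freezes the random set where [U > u]; for a frozen set
    the event is about [S] and [Z] alone, and uniformity of [S] gives the
    expected supremum ([probability_Q_exceeds]); Fubini for [(Z, U)] then
    unfreezes the set ([probability_thinned_exceedance]).

    Events and suprema over the whole of [[0, 1]] reduce to one sequence of times,
    the rationals together with the finitely many discontinuities of [f]: the
    paths of [U] and [Z] are continuous and [U > u] is an open condition, so a
    strict exceedance at a continuity point of [f] persists nearby
    ([exceedance_enumeration]).  The thinned process is a generator because [Z]
    and [U] are independent and [P (U_t > u) = 1 - u].

    The one-dimensional laws follow from the distribution functions: the part of
    [V_t] above [K] is already uniform there, [xi] supplies the rest, and the same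
    splicing at [u] turns [U_t] and [Q_t] into [Y_t].

    Finally, at a fixed [t] the paths of [Y] converge to [Y_t] along [t_n -> t]
    unless [U_t = u] or [S = - K * Z_t], the places where [Y] switches between
    its pieces.  Both events are null, and almost sure convergence implies
    convergence in probability ([Y_process_continuous_in_probability]). *)

Set Implicit Arguments.
Unset Strict Implicit.
Unset Printing Implicit Defensive.

Import Order.TTheory GRing.Theory Num.Theory.
Import numFieldTopology.Exports numFieldNormedType.Exports.

Local Open Scope classical_set_scope.
Local Open Scope ring_scope.

(** * Fubini for independent sigma-algebras *)

Section independence.
Context {R : realType} {d : measure_display} {T : measurableType d}.
Variable P : probability T R.

(** Fubini's theorem for independent random elements: their joint law is the
    product of their laws. *)
Lemma integral_indep {d1 d2 : measure_display} {T1 : measurableType d1}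
    {T2 : measurableType d2} (X : T -> T1) (Y : T -> T2) (h : T1 * T2 -> \bar R) :
  measurable_fun setT X -> measurable_fun setT Y ->
  (forall A B, measurable A -> measurable B ->
    P (X @^-1` A `&` Y @^-1` B) = (P (X @^-1` A) * P (Y @^-1` B))%E) ->
  measurable_fun setT h -> (forall z, 0 <= h z)%E ->
  (\int[P]_w h (X w, Y w) = \int[P]_w' \int[P]_w h (X w, Y w'))%E.
Proof.
move=> mX mY indXY mh h0.
pose X' : {mfun T >-> T1} := HB.pack X (isMeasurableFun.Build _ _ _ _ X mX).
pose Y' : {mfun T >-> T2} := HB.pack Y (isMeasurableFun.Build _ _ _ _ Y mY).
have mXY : measurable_fun setT (fun w => (X w, Y w)).
  exact: measurable_fun_pair.
pose XY' : {mfun T >-> (T1 * T2)%type} :=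
  HB.pack (fun w => (X w, Y w)) (isMeasurableFun.Build _ _ _ _ _ mXY).
have -> : (\int[P]_w h (X w, Y w) = \int[distribution P XY']_z h z)%E.
  by rewrite ge0_integral_distribution.
rewrite (eq_measure_integral (distribution P X' \x distribution P Y')%E); last first.
  by move=> A mA _; apply/esym; apply: product_measure_unique.
rewrite fubini_tonelli2//.
transitivity (\int[P]_w' (fubini_G (distribution P X') h \o Y') w')%E.
  rewrite ge0_integral_distribution//.
    exact: measurable_fun_fubini_tonelli_G.
  by move=> y; apply: integral_ge0.
apply: eq_integral => w' _ /=; rewrite /fubini_G/=.
rewrite ge0_integral_distribution//.
exact: measurableT_comp.
Qed.

End independence.

Section sigma_types.
Context {R : realType} {d : measure_display} {T : measurableType d}.
Variable P : probability T R.

(** The sample space carrying only the sigma-algebra generated by [F].  On such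
    copies independence of sigma-algebras becomes independence of two identity
    maps, so that Fubini applies to whole processes. *)
Definition sigma_type (F : set (T -> R)) : Type :=
  g_sigma_algebraType
    (\bigcup_(X in F) preimage_set_system setT X (measurable : set (set R))).

HB.instance Definition _ F := Measurable.on (sigma_type F).

Lemma measurable_sigma_type (F : set (T -> R)) X :
  F X -> measurable_fun [set: sigma_type F] (X : sigma_type F -> R).
Proof.
move=> FX _ A mA; apply: sub_sigma_algebra.
by exists X => //; exists A.
Qed.

Lemma measurable_to_sigma_type (F : set (T -> R)) :
  (forall X, F X -> measurable_fun setT X) ->
  measurable_fun setT (idfun : T -> sigma_type F).
Proof.
move=> mF; apply: (@measurability _ _ T (sigma_type F) setT idfun
  (\bigcup_(X in F) preimage_set_system setT X (measurable : set (set R)))) => //.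
move=> _ [_ [X FX [A mA <-]] <-]; rewrite !setTI.
by rewrite -[X in measurable X]setTI; exact: mF.
Qed.

Variables F G : set (T -> R).
Hypotheses (mF : forall X, F X -> measurable_fun setT X)
           (mG : forall X, G X -> measurable_fun setT X).
Hypothesis FG : independent P (sigma_of F) (sigma_of G).

(** If [h] depends on its first argument through [F] and on its second one
    through [G], the two occurrences of the sample point can be decoupled. *)
Lemma independent_integral (h : sigma_type F * sigma_type G -> \bar R) :
  measurable_fun setT h -> (forall z, 0 <= h z)%E ->
  (\int[P]_w h (w, w) = \int[P]_w' \int[P]_w h (w, w'))%E.
Proof.
move=> mh h0.
apply: (@integral_indep _ _ _ P _ _ (sigma_type F) (sigma_type G) idfun idfun h) => //.
- exact: measurable_to_sigma_type.
- exact: measurable_to_sigma_type.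
Qed.

Lemma independent_probability (E : set (sigma_type F * sigma_type G)) :
  measurable E ->
  P [set w | E (w, w)] = (\int[P]_w' P [set w | E (w, w')])%E.
Proof.
move=> mE.
have mid1 := measurable_to_sigma_type mF.
have mid2 := measurable_to_sigma_type mG.
have PE (A : set T) : measurable A -> P A = (\int[P]_w (\1_A w)%:E)%E.
  by move=> mA; rewrite integral_indic// setIT.
have mpre (f : T -> sigma_type F * sigma_type G) :
    measurable_fun setT f -> measurable (f @^-1` E).
  by move=> mf; rewrite -[X in measurable X]setTI; exact: mf.
rewrite PE; last exact: mpre (measurable_fun_pair mid1 mid2).
transitivity (\int[P]_w (fun z => (\1_E z)%:E) (w, w))%E; first by [].
rewrite (@independent_integral (fun z => (\1_E z)%:E))//; last first.
  by apply/measurable_EFinP; exact: measurable_indic.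
apply: eq_integral => w' _; rewrite PE//.
exact: mpre (measurable_fun_pair mid1 (measurable_cst (w' : sigma_type G))).
Qed.

End sigma_types.

(** * Uniform random variables *)

Section uniform.
Context {R : realType}.

Lemma uniform_probE (a b : R) (ab : a < b) (A : set R) : measurable A ->
  uniform_prob ab A = ((b - a)^-1%:E * lebesgue_measure (A `&` `[a, b]))%E.
Proof.
move=> mA; rewrite /uniform_prob integral_uniform_pdf.
rewrite -integral_cst; last exact: measurableI.
apply: eq_integral => x; rewrite inE => -[_ /=]; rewrite in_itv/= => xab.
by rewrite /uniform_pdf xab.
Qed.

Context {d : measure_display} {T : measurableType d}.
Variable P : probability T R.

Lemma uniform_rv_le (a b : R) (ab : a < b) (X : T -> R) x :
  uniform_rv P ab X -> a <= x <= b ->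
  P [set w | X w <= x] = ((x - a) / (b - a))%:E.
Proof.
move=> [mX XE] /andP[ax xb].
have -> : [set w | X w <= x] = X @^-1` `]-oo, x].
  by apply/seteqP; split => w /=; rewrite in_itv.
rewrite -[LHS]/(pushforward P X `]-oo, x]) XE// uniform_probE//.
rewrite (_ : _ `&` _ = `[a, x]%classic); last first.
  apply/seteqP; split => y /=; rewrite !in_itv/=.
    by move=> [-> /andP[->]].
  by move=> /andP[-> yx]; rewrite yx (le_trans yx).
rewrite lebesgue_measure_itv/= lte_fin.
case: ltP => [_|xa]; first by rewrite -EFinB -EFinM mulrC.
have -> : x = a by apply/le_anti; rewrite xa ax.
by rewrite mule0 subrr mul0r.
Qed.

Lemma uniform_rv_eq (a b : R) (ab : a < b) (X : T -> R) x :
  uniform_rv P ab X -> P [set w | X w = x] = 0%E.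
Proof.
move=> [mX XE].
rewrite -[LHS]/(pushforward P X [set x]) XE// uniform_probE//.
rewrite [X in (_ * X)%E](_ : _ = 0%E) ?mule0//.
apply: (subset_measure0 _ _ _ (lebesgue_measure_set1 x)) => //.
exact: measurableI.
Qed.

Lemma uniform_rv_lt (a b : R) (ab : a < b) (X : T -> R) x :
  uniform_rv P ab X -> a <= x <= b ->
  P [set w | X w < x] = ((x - a) / (b - a))%:E.
Proof.
move=> uX xab; rewrite -(uniform_rv_le uX xab).
have [mX _] := uX.
have mE : measurable [set w | X w = x].
  by have := mX measurableT _ (measurable_set1 x); rewrite setTI.
have mL : measurable [set w | X w < x].
  have := mX measurableT _ (measurable_itv `]-oo, x[); rewrite setTI.
  by congr measurable; apply/seteqP; split => w /=; rewrite in_itv.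
have -> : [set w | X w <= x] = [set w | X w < x] `|` [set w | X w = x].
  apply/seteqP; split => w /=; rewrite le_eqVlt.
    by move=> /orP[/eqP|]; [right|left].
  by move=> [->|->]; rewrite ?eqxx ?orbT.
rewrite measureU//; last first.
  by apply/seteqP; split => w //= [/[swap] ->]; rewrite ltxx.
by rewrite [X in (_ + X)%E](uniform_rv_eq x uX) adde0.
Qed.

Lemma uniform_rv_negligible (a b : R) (ab : a < b) (X : T -> R) :
  uniform_rv P ab X -> P.-negligible [set w | ~ (a < X w < b)].
Proof.
move=> [mX XE]; exists (X @^-1` (~` `]a, b[)); split.
- by rewrite -[X in measurable X]setTI; apply: mX => //; exact: measurableC.
- rewrite -[LHS]/(pushforward P X _) XE; last exact: measurableC.
  rewrite uniform_probE//; last exact: measurableC.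
  rewrite [X in (_ * X)%E](_ : _ = 0%E) ?mule0//.
  apply: (@subset_measure0 _ _ _ lebesgue_measure _ ([set a] `|` [set b])).
  + by apply: measurableI => //; exact: measurableC.
  + exact: measurableU.
  + move=> x [/= ] /[!in_itv]/= axb /andP[ax xb].
    have [->|xa] := eqVneq x a; [by left|].
    have [->|xb'] := eqVneq x b; [by right|].
    by exfalso; apply: axb; rewrite !lt_neqAle ax xb xb' eq_sym xa.
  + have E := @measureU0 _ _ _
      (lebesgue_measure : {measure set (measurableTypeR R) -> \bar R})
      [set a] [set b] (measurable_set1 a) (measurable_set1 b)
      (lebesgue_measure_set1 b).
    by rewrite [LHS]E; exact: lebesgue_measure_set1.
- by move=> w /= Hw; rewrite in_itv.
Qed.

(** Only levels in [[0, 1]] need checking: monotonicity of the distribution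
    function forces its values elsewhere, and the half-lines form a
    pi-system generating the Borel sets. *)
Lemma uniform01_cdf (X : T -> R) : measurable_fun setT X ->
  (forall x, 0 <= x <= 1 -> P [set w | X w <= x] = x%:E) ->
  uniform_rv P (ltr01 : 0 < 1 :> R) X.
Proof.
move=> mX cdfX; split=> // A mA.
(* [uniform_prob] is a measure on [measurableTypeR R]; so is the law of [X'] *)
pose X' : {mfun T >-> measurableTypeR R} :=
  HB.pack (X : T -> measurableTypeR R)
    (isMeasurableFun.Build _ _ T (measurableTypeR R) X mX).
pose G := [set B : set R | exists x, B = `]-oo, x]%classic].
have mG : measurable = <<s G >> :> set (set R).
  rewrite [LHS](RGenInftyO.measurableE R); apply/seteqP; split.
    apply: smallest_sub; first exact: smallest_sigma_algebra.
    move=> _ [x ->].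
    rewrite (_ : `]-oo, x[%classic = \bigcup_n `]-oo, (x - n.+1%:R^-1)]%classic).
      apply: sigma_algebra_bigcup => n; apply: sub_sigma_algebra.
      by exists (x - n.+1%:R^-1).
    apply/seteqP; split => y /=; rewrite in_itv/=.
      move=> yx; have [n] := ltr_add_invr yx.
      move=> yn; exists n => //=; rewrite in_itv/= lerBrDr; exact: ltW.
    move=> [n _ /=]; rewrite in_itv/= => /le_lt_trans; apply.
    by rewrite ltrBlDr ltrDl invr_gt0.
  rewrite -[X in _ `<=` X](RGenInftyO.measurableE R).
  apply: smallest_sub; first exact: sigma_algebra_measurable.
  by move=> _ [x ->]; exact: measurable_itv.
pose m1 : {measure set (measurableTypeR R) -> \bar R} := distribution P X'.
pose m2 : {measure set (measurableTypeR R) -> \bar R} := uniform_prob (@ltr01 R).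
suff E : forall B, G B -> m1 B = m2 B.
  apply: (@measure_unique _ R (measurableTypeR R) G
    (fun n => `]-oo, n%:R]%classic) mG _ _ _ m1 m2 E) => //.
  - move=> _ _ [x ->] [y ->]; exists (Order.min x y).
    by apply/seteqP; split => z /=; rewrite !in_itv/= le_min => /andP.
  - by move=> n; exists n%:R.
  - apply/seteqP; split => // x _; exists (Num.bound `|x|) => //=.
    rewrite in_itv/= (le_trans (ler_norm x))// ltW//.
    by rewrite archi_boundP.
  - by move=> k; rewrite -ge0_fin_numE// fin_num_measure.
move=> _ [x ->].
have XE y : P [set w | X w <= y] = m1 `]-oo, y]%classic.
  by congr (P _); apply/seteqP; split => w /=; rewrite in_itv.
have [x0|x0] := ltP x 0.
  have -> : m1 `]-oo, x]%classic = 0%E.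
    apply: (@subset_measure0 _ _ _ m1 _ `]-oo, 0]%classic) => //.
    - by apply: subset_itvl; rewrite bnd_simp ltW.
    - by rewrite -[LHS](XE 0) cdfX// lexx ler01.
  apply/esym; rewrite /m2/= uniform_probE//.
  rewrite (_ : _ `&` _ = set0) ?measure0 ?mule0//.
  apply/seteqP; split => y //= []; rewrite !in_itv/= => yx /andP[y0 _].
  by move: (le_lt_trans (le_trans y0 yx) x0); rewrite ltxx.
rewrite /m2/= uniform_probE//.
have [x1|x1] := leP x 1.
  rewrite -[LHS](XE x) cdfX ?x0//.
  rewrite (_ : _ `&` _ = `[0, x]%classic); last first.
    apply/seteqP; split => y /=; rewrite !in_itv/=.
      by move=> [-> /andP[->]].
    by move=> /andP[-> yx]; rewrite yx (le_trans yx).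
  rewrite lebesgue_measure_itv/= lte_fin subr0 invr1 mul1e.
  have [_|x0'] := ltP 0 x; first by rewrite -EFinB subr0.
  by congr EFin; apply/le_anti; rewrite x0' x0.
rewrite (_ : _ `&` _ = `[0, 1]%classic); last first.
  apply/seteqP; split => y /=; rewrite !in_itv/=; first by case.
  by move=> /andP[-> y1]; rewrite y1 (le_trans y1)// ltW.
rewrite lebesgue_measure_itv/= lte_fin ltr01 subr0 invr1 mul1e -EFinB subr0.
apply/eqP; rewrite eq_le probability_le1//=.
rewrite -[X in (X <= _)%E](cdfX 1 _) ?ler01 ?lexx//.
rewrite [leLHS](XE 1); apply: (@le_measure _ _ _ m1); rewrite ?inE//.
by apply: subset_itvl; rewrite bnd_simp ltW.
Qed.

End uniform.

(** * Measurability and exceedances at one time *)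

Section tools.
Context {R : realType} {d : measure_display} {T : measurableType d}.
Variable P : probability T R.

Lemma sigma_of_preimage (F : set (T -> R)) X (A : set R) :
  F X -> measurable A -> sigma_of F (X @^-1` A).
Proof.
move=> FX mA; apply: sub_sigma_algebra; exists X => //; exists A => //.
by rewrite setTI.
Qed.

Lemma probability_eq_ae (N A B : set T) : P.-negligible N ->
  measurable A -> measurable B -> (forall w, ~ N w -> A w <-> B w) ->
  P A = P B.
Proof.
move=> [N' [mN' N'0 NN']] mA mB AB.
rewrite -(measureU0 mA mN' N'0) -(measureU0 mB mN' N'0); congr (P _).
apply/seteqP; split => w [Ww|]; [|by right| |by right];
  have [N'w|N'w] := pselect (N' w); [by right|left|by right|left];
  by apply/(AB w) => // /NN'.
Qed.

Lemma measurable_sup_range (h : nat -> T -> R) :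
  (forall w, has_ubound (range (h ^~ w))) ->
  (forall k, measurable_fun setT (h k)) ->
  measurable_fun setT (fun w => sup (range (h ^~ w))).
Proof.
move=> ub mh.
rewrite (_ : (fun w => _) = (fun w => sups (h ^~ w) 0%N)).
  by apply: measurable_fun_sups => // w _; exact: ub.
apply/funext => w; rewrite /sups /sdrop/=; congr (sup _).
by apply/seteqP; split => _ [k _ <-]; exists k.
Qed.

Lemma lt_supP (A : set R) y : A !=set0 -> has_ubound A ->
  y < sup A <-> exists2 x, A x & y < x.
Proof.
move=> A0 ubA; split; first exact: sup_gt.
by move=> [x Ax yx]; rewrite (lt_le_trans yx)// ub_le_sup.
Qed.

Lemma measurable_lt_fun (f g : T -> R) :
  measurable_fun setT f -> measurable_fun setT g ->
  measurable [set w | f w < g w].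
Proof.
move=> mf mg; have mtrue : measurable [set true] by [].
have := measurable_fun_ltr mf mg measurableT mtrue; rewrite setTI.
by congr measurable; apply/seteqP; split => w.
Qed.

Lemma measurable_le_fun (f g : T -> R) :
  measurable_fun setT f -> measurable_fun setT g ->
  measurable [set w | f w <= g w].
Proof.
move=> mf mg; have mtrue : measurable [set true] by [].
have := measurable_fun_ler mf mg measurableT mtrue; rewrite setTI.
by congr measurable; apply/seteqP; split => w.
Qed.

Lemma measurable_eq_fun (f g : T -> R) :
  measurable_fun setT f -> measurable_fun setT g ->
  measurable [set w | f w = g w].
Proof.
move=> mf mg; have mtrue : measurable [set true] by [].
have := measurable_fun_eqr mf mg measurableT mtrue; rewrite setTI.
by congr measurable; apply/seteqP; split => w /= /eqP.
Qed.

End tools.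

Section uniform_threshold.
Context {R : realType} {d : measure_display} {T : measurableType d}.
Variable P : probability T R.
Variables (S : T -> R) (F : set (T -> R)).
Hypothesis S_unif : uniform_rv P ltr01 S.
Hypothesis mF : forall X, F X -> measurable_fun setT X.
Hypothesis SF : independent P (sigma_rv S) (sigma_of F).
Variable h : T -> R.
Hypothesis mh : measurable_fun [set: sigma_type F] (h : sigma_type F -> R).

Let mS1 : forall X, [set S] X -> measurable_fun setT X.
Proof. by move=> _ ->; case: S_unif. Qed.

Let mS' : measurable_fun setT
  (fun z : sigma_type [set S] * sigma_type F => S z.1).
Proof.
exact: measurableT_comp (@measurable_sigma_type _ _ _ [set S] S erefl) _.
Qed.

Let mh' : measurable_fun setT
  (fun z : sigma_type [set S] * sigma_type F => h z.2).
Proof. exact: measurableT_comp mh _. Qed.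

(** Conditionally on [h], the event has probability [h], by uniformity. *)
Lemma uniform_lt_expectation : (forall w, 0 <= h w <= 1) ->
  P [set w | S w < h w] = ('E_P[h])%E.
Proof.
move=> h01.
have -> := independent_probability mS1 mF SF (measurable_lt_fun mS' mh').
rewrite unlock; apply: eq_integral => w' _ /=.
by rewrite (uniform_rv_lt S_unif)// subr0 subr0 divr1.
Qed.

(** Conditionally on [h] this is an event about one value of [S], and [S] has
    no atoms. *)
Lemma uniform_eq_indep : P [set w | S w = h w] = 0%E.
Proof.
have -> := independent_probability mS1 mF SF (measurable_eq_fun mS' mh').
rewrite -[RHS](integral0 P setT); apply: eq_integral => w' _ /=.
exact: uniform_rv_eq S_unif.
Qed.

End uniform_threshold.

Lemma Y_processE {R : realType} {T : Type} (u : R) (U Q : R -> T -> R) t w :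
  Y_process u U Q t w = if u < U t w then u + (1 - u) * Q t w else U t w.
Proof.
rewrite /Y_process leNgt; case: (u < U t w) => /=.
  by rewrite mulr0 add0r mulr1.
by rewrite mulr0 addr0 mulr1.
Qed.

Section pointwise.
Context {R : realType} {T : Type}.
Variables (c M : R) (S xi : T -> R) (Z : R -> T -> R) (t : R) (w : T).
Hypotheses (S0 : 0 < S w) (Z0 : 0 <= Z t w).
Let K := K_const c M.

(** Truncation at [M] cannot change the comparison with a level that is at
    least [M]; the formulation by products also covers [Z t w = 0]. *)
Lemma V_process_gt (theta : R) : theta <= - M -> 
  (- theta < V_process M S Z t w) = (S w < theta * Z t w).
Proof.
move=> tM; rewrite /V_process; case: eqVneq => [->|Zn0].
  by rewrite mulr0 !ltNge lerNr tM ltW.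
have Zp : 0 < Z t w by rewrite lt_neqAle eq_sym Zn0.
rewrite lt_max ltNge lerNr tM /=.
by rewrite mulNr ltrN2 ltr_pdivrMr.
Qed.

Lemma V_process_above (theta : R) : theta <= - M ->
  S w < theta * Z t w -> V_process M S Z t w = - S w / Z t w.
Proof.
move=> tM; rewrite /V_process; case: eqVneq => [->|Zn0]; first by rewrite mulr0 ltNge ltW.
have Zp : 0 < Z t w by rewrite lt_neqAle eq_sym Zn0.
move=> Sl; apply/max_idPr; rewrite mulNr lerNr.
rewrite ler_pdivrMr//.
by apply: (le_trans (ltW Sl)); rewrite ler_pM2r.
Qed.

(** Replacing low values of [V] by [xi] is invisible from above: both stay
    below [K <= - theta]. *)
Lemma Q_process_gt (theta : R) : xi w <= K -> theta <= - K ->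
  (1 - theta < Q_process c M S xi Z t w) = (S w < theta * Z t w).
Proof.
move=> xiK tK.
have KM : - K <= - M by rewrite lerN2 /K /K_const le_max lexx.
have tM : theta <= - M by exact: le_trans KM.
rewrite /Q_process -/K addrC ltrD2r -V_process_gt//.
have [//|VK] := ltP K; apply/idP/idP => H; exfalso.
  by move: tK xiK H; lra.
by move: tK VK H; lra.
Qed.

End pointwise.

(** * The generalized Pareto copula process *)

Section pareto_copula.
Context {R : realType} {d : measure_display} {T : measurableType d}.
Variable P : probability T R.
Variables (Z : R -> T -> R) (S xi : T -> R) (c M : R).
Hypothesis Z_gen : generator_process P c Z.
Hypothesis M_lt0 : M < 0.
Let K := K_const c M.
Hypothesis K_gtN1 : -1 < K.
Hypothesis S_unif : uniform_rv P ltr01 S.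
Hypothesis S_indep_Z : independent P (sigma_rv S) (sigma_process Z).
Hypothesis xi_unif : uniform_rv P K_gtN1 xi.
Hypothesis xi_indep_V :
  independent P (sigma_rv xi) (sigma_process (V_process M S Z)).
Let V := V_process M S Z.
Let Q := Q_process c M S xi Z.

Lemma measurable_generator t : I01 t -> measurable_fun setT (Z t).
Proof. by case: Z_gen => _ /[apply] -[]. Qed.

Lemma generator_ge0 t w : I01 t -> 0 <= Z t w.
Proof. by case: Z_gen => _ /[apply] -[_ /(_ w)/andP[]]. Qed.

Lemma generator_le t w : I01 t -> Z t w <= c.
Proof. by case: Z_gen => _ /[apply] -[_ /(_ w)/andP[]]. Qed.

Lemma generator_expectation t : I01 t -> ('E_P[Z t] = 1)%E.
Proof. by case: Z_gen => _ /[apply] -[]. Qed.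

Let c_gt0 : 0 < c.
Proof. by case: Z_gen => c1 _; rewrite (lt_le_trans ltr01). Qed.

Lemma K_const_lt0 : K < 0.
Proof. by rewrite /K /K_const gt_max M_lt0 oppr_lt0 invr_gt0. Qed.

(** This is where the part [- 1 / c <= K] of the definition of [K] enters. *)
Lemma weighted_generator_le1 theta t w : I01 t -> 0 <= theta <= - K ->
  0 <= theta * Z t w <= 1.
Proof.
move=> It /andP[t0 tK]; rewrite mulr_ge0 ?generator_ge0//=.
have cn0 : c != 0 by rewrite gt_eqF.
rewrite -(mulVf cn0) ler_pM ?generator_ge0 ?generator_le//.
by rewrite (le_trans tK)// lerNl /K /K_const le_max lexx orbT.
Qed.

(** A null set outside which [S] is positive and [xi] stays below [K]; being
    uniform only constrains laws, so these may fail at some points. *)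
Definition exceptional : set T :=
  [set w | ~ (0 < S w < 1)] `|` [set w | ~ (-1 < xi w < K)].

Lemma exceptional_negligible : P.-negligible exceptional.
Proof.
apply: negligibleU.
  exact: uniform_rv_negligible S_unif.
exact: uniform_rv_negligible xi_unif.
Qed.

Lemma not_exceptional w : ~ exceptional w -> 0 < S w /\ xi w <= K.
Proof.
move=> /not_orP[/contrapT/andP[S0 _] /contrapT/andP[_ xiK]].
by split => //; exact: ltW.
Qed.

Lemma measurable_V_process t : I01 t -> measurable_fun setT (V t).
Proof.
move=> It; have mZ := measurable_generator It; have [mS _] := S_unif.
apply: measurable_fun_ifT => //=.
  exact: measurable_fun_eqr.
apply: (measurable_maxr (measurable_cst M)); apply: measurable_funM.
  exact: measurableT_comp.
(* an inverse of a nonnegative function is a power *)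
rewrite (_ : (fun w => _) = (fun w => powR (Z t w) (-1))).
  exact: (@measurableT_comp _ _ _ _ _ _ (@powR R ^~ (-1))).
by apply/funext => w; rewrite powR_inv1 ?generator_ge0.
Qed.

Lemma measurable_Q_process t : I01 t -> measurable_fun setT (Q t).
Proof.
move=> It; have mV := measurable_V_process It; have [mxi _] := xi_unif.
apply: measurable_funD => //; apply: measurable_fun_ifT => //=.
exact: measurable_fun_ltr.
Qed.

Let mZ' : forall X, [set Z t | t in I01] X -> measurable_fun setT X.
Proof. by move=> _ [t It <-]; exact: measurable_generator. Qed.

Lemma measurable_sup_generator (t : nat -> R) (theta : nat -> R) :
  (forall k, I01 (t k)) -> (forall k, 0 <= theta k <= - K) ->
  measurable_fun [set: sigma_type [set Z t | t in I01]]
    (fun w => sup (range (fun k => theta k * Z (t k) w))).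
Proof.
move=> It th; apply: measurable_sup_range.
  move=> w; exists 1 => _ [k _ <-].
  by have /andP[] := weighted_generator_le1 w (It k) (th k).
move=> k; apply: measurable_funM => //; apply: measurable_sigma_type.
by exists (t k).
Qed.

(** Almost surely [Q] exceeds one of the levels iff [S] is smaller than the
    weighted supremum of [Z], which takes its values in [[0, 1]]. *)
Lemma probability_Q_exceeds (t : nat -> R) (theta : nat -> R) :
  (forall k, I01 (t k)) -> (forall k, 0 <= theta k <= - K) ->
  P [set w | exists k, 1 - theta k < Q (t k) w] =
  ('E_P[fun w => sup (range (fun k => (theta k * Z (t k) w)%R))])%E.
Proof.
move=> It th.
have ms := measurable_sup_generator It th.
have ubs w : has_ubound (range (fun k => theta k * Z (t k) w)).
  exists 1 => _ [k _ <-].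
  by have /andP[] := weighted_generator_le1 w (It k) (th k).
rewrite -(uniform_lt_expectation S_unif mZ' S_indep_Z ms); last first.
  move=> w; apply/andP; split.
    apply: (@le_trans _ _ (theta 0%N * Z (t 0%N) w)).
      by have /andP[] := weighted_generator_le1 w (It 0%N) (th 0%N).
    by apply: ub_le_sup => //; exists 0%N.
  apply: ge_sup; first by exists (theta 0%N * Z (t 0%N) w); exists 0%N.
  by move=> _ [k _ <-]; have /andP[] := weighted_generator_le1 w (It k) (th k).
apply: (probability_eq_ae exceptional_negligible).
- rewrite (_ : [set w | _] = \bigcup_k [set w | 1 - theta k < Q (t k) w]).
    apply: bigcupT_measurable => k; apply: measurable_lt_fun => //.
    exact: measurable_Q_process.
  by apply/seteqP; split => w [k]; exists k.
- apply: measurable_lt_fun; first by case: S_unif.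
  have mid := measurable_to_sigma_type mZ'.
  exact: (measurableT_comp ms mid).
- move=> w /not_exceptional[S0 xiK] /=.
  rewrite lt_supP//; last by exists (theta 0%N * Z (t 0%N) w); exists 0%N.
  have E k : (1 - theta k < Q (t k) w) = (S w < theta k * Z (t k) w).
    by apply: Q_process_gt => //; [exact: generator_ge0|case/andP: (th k)].
  split => [[k]|[_ [k _ <-] H]].
    by rewrite E => H; exists (theta k * Z (t k) w) => //; exists k.
  by exists k; rewrite E.
Qed.

Lemma probability_Q_gt t theta : I01 t -> 0 <= theta <= - K ->
  P [set w | 1 - theta < Q t w] = theta%:E.
Proof.
move=> It th.
have := probability_Q_exceeds (fun _ : nat => It) (fun _ => th).
rewrite (_ : [set w | exists k : nat, _] = [set w | 1 - theta < Q t w]); last first.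
  by apply/seteqP; split => w => [[]//|]; exists 0%N.
move=> ->.
rewrite (_ : (fun w => _) = (theta \o* Z t)); last first.
  apply/funext => w /=; rewrite (_ : range _ = [set theta * Z t w]) ?sup1 1?mulrC//.
  by apply/seteqP; split => [_ [k _ <-]//|_ ->]; exists 0%N.
have mZ := measurable_generator It.
transitivity (theta%:E * 'E_P[Z t])%E; last by rewrite generator_expectation// mule1.
rewrite unlock -ge0_integralZl//.
- by apply: eq_integral => w _; rewrite /= -EFinM mulrC.
- exact/measurable_EFinP.
- by move=> w _; rewrite lee_fin generator_ge0.
- by rewrite lee_fin; case/andP: th.
Qed.

(** Levels [x >= 1 + K] are governed by [V] alone.  Below [1 + K] the event
    [Q_t <= x] is [V_t <= K] together with [xi <= x - 1], and independence gives
    [(1 + K) * (x / (1 + K)) = x]. *)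
Lemma Q_process_copula : copula_process P Q.
Proof.
move=> t It; have mQ := measurable_Q_process It.
apply: uniform01_cdf => // x /andP[x0 x1].
have mV := measurable_V_process It.
have [mxi _] := xi_unif.
have K0 := K_const_lt0.
have [Kx|xK] := leP (1 + K) x.
  rewrite (_ : [set w | _] = ~` [set w | 1 - (1 - x) < Q t w]); last first.
    by apply/seteqP; split => w /=; rewrite subKr leNgt => /negP.
  rewrite probability_setC ?probability_Q_gt//; last exact: measurable_lt_fun.
    by rewrite -EFinB subKr.
  lra.
rewrite (_ : [set w | _] = xi @^-1` `]-oo, x - 1] `&` V t @^-1` `]-oo, K]); last first.
  apply/seteqP; split => w /=; rewrite !in_itv/= /Q /Q_process -/K -/V.
    have [KV H|VK] := ltP K; last by rewrite lerBrDr.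
    by exfalso; move: KV H xK; rewrite /V; lra.
  by move=> [xix VK]; rewrite ltNge VK/= -lerBrDr.
rewrite xi_indep_V; last 2 first.
- exact: sigma_of_preimage.
- by apply: sigma_of_preimage => //; exists t.
have -> : P (xi @^-1` `]-oo, x - 1]) = ((x - 1 - (-1)) / (K - (-1)))%:E.
  rewrite -(uniform_rv_le xi_unif); last lra.
  by congr (P _); apply/seteqP; split => w /=; rewrite in_itv.
have -> : P (V t @^-1` `]-oo, K]) = (1 + K)%:E.
  transitivity (P (~` [set w | 1 - (- K) < Q t w])).
    apply: (probability_eq_ae exceptional_negligible).
    - by rewrite -[X in measurable X]setTI; exact: mV.
    - by apply: measurableC; exact: measurable_lt_fun.
    - move=> w /not_exceptional[S0 xiK] /=.
      rewrite Q_process_gt//; last exact: generator_ge0.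
      rewrite -(@V_process_gt _ _ M) ?generator_ge0//; last first.
        by rewrite lerN2 /K /K_const le_max lexx.
      by rewrite opprK in_itv/= leNgt; split => /negP.
  rewrite probability_setC ?probability_Q_gt//; last exact: measurable_lt_fun.
    by rewrite -EFinB opprK.
  by rewrite lexx andbT; lra.
rewrite -EFinM; congr EFin.
rewrite !opprK subrK (addrC K) mulfVK//.
by rewrite gt_eqF//; lra.
Qed.

End pareto_copula.

(** * Reduction to countably many times and the thinned generator *)

Section dense_enumeration.
Context {R : realType}.

Lemma rational_near_I01 (t : R) (W : set R) : I01 t -> within I01 (nbhs t) W ->
  exists q : rat, I01 (ratr q : R) /\ W (ratr q).
Proof.
rewrite /I01 /= in_itv/= => /andP[t0 t1] [e /= e0 eW].
have lohi : Num.max 0 (t - e) < Num.min 1 (t + e).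
  by rewrite gt_max !lt_min ltr01/=; lra.
have [q] := rat_in_itvoo lohi.
rewrite in_itv/= gt_max lt_min => /andP[/andP[q0 qt] /andP[q1 tq]].
have Iq : I01 (ratr q : R) by rewrite /I01/= in_itv/= !ltW.
exists q; split => //; apply: eW => //=.
by rewrite ltr_norml; lra.
Qed.

(** One sequence runs through the rationals of [[0, 1]], which are dense, and
    through the finitely many discontinuities of [f]. *)
Lemma E01_dense_enumeration (f : R -> R) : E01 f ->
  exists q : nat -> R, [/\ forall k, I01 (q k),
    forall t W, I01 t -> within I01 (nbhs t) W -> exists k, W (q k) &
    forall t, I01 t ->
      (exists k, q k = t) \/ (f s @[s --> within I01 (nbhs t)] --> f t)].
Proof.
move=> [_ /finite_seqP[disc discE]].
pose x (k : nat) : R := match (unpickle k : option (rat + nat)) with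
  | Some (inl r) => ratr r | Some (inr i) => nth 0 disc i | None => 0 end.
(* entries outside [[0, 1]] are replaced by the default time 0 *)
pose q k := if x k \in I01 then x k else 0.
have qx k : I01 (x k) -> q k = x k by move=> Ix; rewrite /q mem_set.
exists q; split.
- move=> k; rewrite /q; case: ifPn => [/set_mem//|_].
  by rewrite /I01/= in_itv/= lexx ler01.
- move=> t W It /(rational_near_I01 It)[r [Ir Wr]].
  by exists (pickle (inl r : rat + nat)); rewrite qx /x pickleK.
- move=> t It; have [ft|ft] := pselect (f s @[s --> within I01 (nbhs t)] --> f t).
    by right.
  have tdisc : [set` disc] t by rewrite -discE.
  left; exists (pickle (inr (index t disc) : rat + nat)).
  have xt : x (pickle (inr (index t disc) : rat + nat)) = t.
    by rewrite /x pickleK nth_index.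
  by rewrite qx xt.
Qed.

End dense_enumeration.

Section sup_lemmas.
Context {R : realType}.

Lemma sup_eq_cofinal (A B : set R) : B `<=` A -> B !=set0 -> has_ubound A ->
  (forall b, B b -> 0 <= b) ->
  (forall a y, A a -> 0 <= y -> y < a -> exists2 b, B b & y < b) ->
  sup A = sup B.
Proof.
move=> BA B0 ubA Bge0 cof.
have ubB : has_ubound B.
  by have [M AM] := ubA; exists M => b /BA; exact: AM.
have sB0 : 0 <= sup B.
  by have [b Bb] := B0; rewrite (le_trans (Bge0 _ Bb))// ub_le_sup.
apply/le_anti/andP; split; last first.
  by apply: ge_sup => // b /BA Ab; exact: ub_le_sup.
apply: ge_sup; first by have [b /BA] := B0; exists b.
move=> a Aa; rewrite leNgt; apply/negP => /(cof _ _ Aa sB0)[b Bb].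
by rewrite ltNge ub_le_sup.
Qed.

Lemma sup_norm_le (f : R -> R) t : bounded_on01 f -> I01 t -> `|f t| <= sup_norm f.
Proof.
move=> [C fC] It; apply: ub_le_sup; last by exists t.
by exists C => _ [s Is <-]; exact: fC.
Qed.

End sup_lemmas.

Section thinning.
Context {R : realType} {d : measure_display} {T : measurableType d}.
Variable P : probability T R.
Variables (U Z : R -> T -> R) (c u : R).
Hypothesis U_copula : copula_process P U.
Hypothesis U_cont : continuous_paths U.
Hypothesis Z_gen : generator_process P c Z.
Hypothesis Z_cont : continuous_paths Z.
Hypothesis Z_indep_U : independent P (sigma_process Z) (sigma_process U).
Hypotheses (u_gt0 : 0 < u) (u_lt1 : u < 1).

(** The generator of the D-norm in the theorem. *)
Definition thinned_generator (t : R) (w : T) : R :=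
  Z t w * ((u < U t w)%R%:R / (1 - u)).

Let mZ' : forall X, [set Z t | t in I01] X -> measurable_fun setT X.
Proof. by move=> _ [t It <-]; exact: measurable_generator Z_gen _ It. Qed.

Let mU' : forall X, [set U t | t in I01] X -> measurable_fun setT X.
Proof. by move=> _ [t It <-]; have [] := U_copula It. Qed.

Let u1_gt0 : 0 < 1 - u. Proof. by rewrite subr_gt0. Qed.

Lemma measurable_exceedance t : I01 t ->
  measurable_fun [set: sigma_type [set U t | t in I01]]
    (fun w => (u < U t w)%R%:R / (1 - u) : R).
Proof.
move=> It; apply: measurable_funM => //.
rewrite (_ : (fun w => _) = (fun w => if u < U t w then 1 else 0)); last first.
  by apply/funext => w; case: ifP.
apply: measurable_fun_ifT => //; apply: measurable_fun_ltr => //.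
by apply: measurable_sigma_type; exists t.
Qed.

Lemma thinned_generator_ge0 t w : I01 t -> 0 <= thinned_generator t w.
Proof.
by move=> It; rewrite mulr_ge0 ?(generator_ge0 Z_gen)// divr_ge0// ltW.
Qed.

Lemma thinned_generator_le t w : I01 t -> thinned_generator t w <= c / (1 - u).
Proof.
move=> It; rewrite /thinned_generator ler_pM ?(generator_ge0 Z_gen)//.
- by rewrite divr_ge0// ltW.
- exact: generator_le Z_gen _ _ It.
- by rewrite ler_pdivrMr// mulVf ?gt_eqF//; case: (u < U t w).
Qed.

Lemma probability_U_gt t : I01 t -> P [set w | u < U t w] = (1 - u)%:E.
Proof.
move=> It; have uU := U_copula It; have [mU _] := uU.
rewrite (_ : [set w | _] = ~` [set w | U t w <= u]); last first.
  by apply/seteqP; split => w /=; rewrite ltNge => /negP.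
rewrite probability_setC; last exact: measurable_le_fun.
by rewrite (uniform_rv_le uU) ?(ltW u_gt0) ?(ltW u_lt1)// !subr0 divr1.
Qed.

Lemma expectation_exceedance t : I01 t ->
  (\int[P]_w ((u < U t w)%R%:R / (1 - u))%:E = 1)%E.
Proof.
move=> It; have [mU _] := U_copula It.
under eq_integral do rewrite mulrC EFinM.
rewrite ge0_integralZl//; last 2 first.
- apply/measurable_EFinP.
  rewrite (_ : (fun w => _) = \1_[set w | u < U t w]).
    by apply: measurable_indic; exact: measurable_lt_fun.
  by apply/funext => w; rewrite indicE mem_setE.
- by rewrite lee_fin invr_ge0 ltW.
rewrite (_ : (fun w => _) = (fun w => (\1_[set w | u < U t w] w)%:E)); last first.
  by apply/funext => w; rewrite indicE mem_setE.
rewrite integral_indic ?setIT//; last exact: measurable_lt_fun.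
by rewrite [X in (_ * X)%E](probability_U_gt It) -EFinM mulVf ?gt_eqF.
Qed.

Lemma measurable_thinned_generator t : I01 t ->
  measurable_fun setT (thinned_generator t).
Proof.
move=> It; have mE := measurable_exceedance It.
have mid := measurable_to_sigma_type mU'.
apply: measurable_funM; first exact: measurable_generator Z_gen _ It.
exact: (measurableT_comp mE mid).
Qed.

(** The mean is one because [Z] and [U] are independent, [E Z_t = 1], and
    [P (U_t > u) = 1 - u]. *)
Lemma thinned_generator_process :
  generator_process P (c / (1 - u)) thinned_generator.
Proof.
have [c1 _] := Z_gen; split.
  by rewrite ler_pdivlMr// mul1r (le_trans _ c1)// lerBlDr lerDl ltW.
move=> t It; have mZ := measurable_generator Z_gen It.
have mE := measurable_exceedance It.
split.
- exact: measurable_thinned_generator.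
- by move=> w; rewrite thinned_generator_ge0// thinned_generator_le.
- rewrite unlock.
  have mZt : measurable_fun [set: sigma_type [set Z t | t in I01]] (Z t).
    by apply: measurable_sigma_type; exists t.
  pose h (z : sigma_type [set Z t | t in I01] * sigma_type [set U t | t in I01]) :=
    (Z t z.1 * ((u < U t z.2)%R%:R / (1 - u)))%:E.
  rewrite [LHS](independent_integral mZ' mU' Z_indep_U (h := h)); last 2 first.
  + apply/measurable_EFinP; apply: measurable_funM.
      exact: (measurableT_comp mZt).
    exact: (measurableT_comp mE).
  + move=> z; rewrite lee_fin mulr_ge0 ?(generator_ge0 Z_gen)//.
    by rewrite divr_ge0// ltW.
  rewrite -[RHS](expectation_exceedance It); apply: eq_integral => w' _ /=.
  transitivity (((u < U t w')%R%:R / (1 - u))%:E * 'E_P[Z t])%E.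
    rewrite unlock -ge0_integralZl//.
    + by apply: eq_integral => w _; rewrite -EFinM mulrC.
    + exact/measurable_EFinP.
    + by move=> w _; rewrite lee_fin (generator_ge0 Z_gen).
    + by rewrite lee_fin divr_ge0// ltW.
  by rewrite (generator_expectation Z_gen)// mule1.
Qed.

End thinning.

Section thinned_norm.
Context {R : realType} {d : measure_display} {T : measurableType d}.
Variable P : probability T R.
Variables (U Z : R -> T -> R) (c u : R).
Hypothesis U_copula : copula_process P U.
Hypothesis U_cont : continuous_paths U.
Hypothesis Z_gen : generator_process P c Z.
Hypothesis Z_cont : continuous_paths Z.
Hypotheses (u_gt0 : 0 < u) (u_lt1 : u < 1).

Let u1_gt0 : 0 < 1 - u. Proof. by rewrite subr_gt0. Qed.

Lemma exceedance_near (f : R -> R) t w y : I01 t ->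
  f s @[s --> within I01 (nbhs t)] --> f t -> u < U t w -> y < `|f t| * Z t w ->
  \forall s \near within I01 (nbhs t), u < U s w /\ y < `|f s| * Z s w.
Proof.
move=> It ft uU yfZ.
have Ut : U s w @[s --> within I01 (nbhs t)] --> U t w.
  by have /subspace_continuousP := @U_cont w; apply.
have Zt : Z s w @[s --> within I01 (nbhs t)] --> Z t w.
  by have /subspace_continuousP := @Z_cont w; apply.
have fZ : `|f s| * Z s w @[s --> within I01 (nbhs t)] --> `|f t| * Z t w.
  by apply: cvgM => //; exact: cvg_norm.
apply: filterI.
  exact: (cvgr_gt _ Ut).
exact: (cvgr_gt _ fZ).
Qed.

Lemma thinned_generator_gt t w a y : 0 <= y ->
  (y < a * thinned_generator U Z u t w) =
  (u < U t w) && (y * (1 - u) < a * Z t w).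
Proof.
rewrite /thinned_generator => y0; case: (u < U t w) => /=.
  by rewrite mul1r mulrA ltr_pdivlMr.
by rewrite mul0r !mulr0 ltNge y0.
Qed.

(** Every strict exceedance is already witnessed along the sequence: at a
    discontinuity of [f] because that time is enumerated, elsewhere because the
    exceedance persists in a neighbourhood, which contains a rational. *)
Lemma exceedance_enumeration (f : R -> R) : E01 f ->
  exists q : nat -> R, (forall k, I01 (q k)) /\
    forall w t y, I01 t -> 0 <= y ->
      y < `|f t| * thinned_generator U Z u t w ->
      exists k, y < `|f (q k)| * thinned_generator U Z u (q k) w.
Proof.
move=> Ef; have [q [Iq dense qf]] := E01_dense_enumeration Ef.
exists q; split=> // w t y It y0 yf.
have [[k qk] | ft] := qf t It; first by exists k; rewrite qk.
move: yf; rewrite thinned_generator_gt// => /andP[uU yf].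
have [k [uUk yfk]] := dense t _ It (exceedance_near It ft uU yf).
by exists k; rewrite thinned_generator_gt// uUk.
Qed.

Lemma weighted_thinned_bounded (f : R -> R) w : bounded_on01 f ->
  has_ubound [set `|f t| * thinned_generator U Z u t w | t in I01].
Proof.
move=> [C fC]; exists (C * (c / (1 - u))) => _ [t It <-].
rewrite ler_pM ?(thinned_generator_ge0 _ Z_gen)//; first exact: fC.
exact: (thinned_generator_le _ Z_gen).
Qed.

Section enumerated.
Variables (f : R -> R) (q : nat -> R).
Hypothesis f_bnd : bounded_on01 f.
Hypothesis q01 : forall k, I01 (q k).
Hypothesis q_enum : forall w t y, I01 t -> 0 <= y ->
  y < `|f t| * thinned_generator U Z u t w ->
  exists k, y < `|f (q k)| * thinned_generator U Z u (q k) w.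

Lemma weighted_sup_enum w : weighted_sup (thinned_generator U Z u) f w =
  sup (range (fun k => `|f (q k)| * thinned_generator U Z u (q k) w)).
Proof.
apply: sup_eq_cofinal.
- by move=> _ [k _ <-]; exists (q k).
- by exists (`|f (q 0%N)| * thinned_generator U Z u (q 0%N) w); exists 0%N.
- exact: weighted_thinned_bounded.
- by move=> _ [k _ <-]; rewrite mulr_ge0 ?(thinned_generator_ge0 _ Z_gen).
- move=> _ y [t It <-] y0 /(q_enum It y0)[k yk].
  by exists (`|f (q k)| * thinned_generator U Z u (q k) w) => //; exists k.
Qed.

Lemma measurable_weighted_sup :
  measurable_fun setT (weighted_sup (thinned_generator U Z u) f).
Proof.
rewrite (funext weighted_sup_enum); apply: measurable_sup_range.
  move=> w; have [C fC] := weighted_thinned_bounded w f_bnd.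
  by exists C => _ [k _ <-]; apply: fC; exists (q k).
move=> k; apply: measurable_funM => //.
exact: (measurable_thinned_generator _ U_copula Z_gen).
Qed.

End enumerated.

End thinned_norm.

(** * Almost sure convergence of the spliced process *)

Section convergence.
Context {R : realType} {d : measure_display} {T : measurableType d}.
Variable P : probability T R.

(** The unions over [k >= n] of the deviation events decrease to an event on
    which the sequence does not converge. *)
Lemma ae_cvg_in_probability (X : nat -> T -> R) (X0 : T -> R) (N : set T) e :
  (forall n, measurable_fun setT (X n)) -> measurable_fun setT X0 ->
  P.-negligible N -> (forall w, ~ N w -> X n w @[n --> \oo] --> X0 w) -> 0 < e ->
  P [set w | e < `|X n w - X0 w|] @[n --> \oo] --> 0%E.
Proof.
move=> mX mX0 negN XX0 e0.
pose A n := [set w | e < `|X n w - X0 w|].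
have mA n : measurable (A n).
  apply: measurable_lt_fun => //.
  by apply: measurableT_comp => //; exact: measurable_funB.
pose F n := \bigcup_(k in [set k | (n <= k)%N]) A k.
have mF n : measurable (F n) by exact: bigcup_measurable.
have mbF : measurable (\bigcap_n F n) by exact: bigcapT_measurable.
have PF0 : P (\bigcap_n F n) = 0%E.
  apply: measure_negligible => //; apply: negligibleS negN => w Fw.
  apply: contrapT => /XX0 /cvgrPdist_lt/(_ _ e0)[n _ nX].
  have [k /= nk] := Fw n I.
  by rewrite /A/= distrC ltNge (ltW (nX k nk)).
have Fcvg : P (F n) @[n --> \oo] --> 0%E.
  rewrite -PF0; apply: nonincreasing_cvg_mu => //.
    by rewrite -ge0_fin_numE// fin_num_measure.
  move=> m n mn; apply/subsetPset => w [k /= nk Ak]; exists k => //=.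
  exact: leq_trans nk.
apply: (squeeze_cvge _ (cvg_cst 0%E) Fcvg).
apply: nearW => n; rewrite measure_ge0/=.
apply: le_measure; rewrite ?inE; [exact: mA|exact: mF|].
by move=> w Aw; exists n => /=.
Qed.

End convergence.

Section pathwise.
Context {R : realType} {T : Type}.
Variables (c M u : R) (S xi : T -> R) (Z U : R -> T -> R) (w : T).
Hypotheses (S0 : 0 < S w) (Z0 : forall t, I01 t -> 0 <= Z t w).
Let K := K_const c M.
Let Q := Q_process c M S xi Z.
Variables (s : nat -> R) (t : R).
Hypotheses (s01 : forall n, I01 (s n)) (It : I01 t).
Hypothesis Zs : Z (s n) w @[n --> \oo] --> Z t w.
Hypothesis Us : U (s n) w @[n --> \oo] --> U t w.

Let K_le : - K <= - M. Proof. by rewrite lerN2 /K /K_const le_max lexx. Qed.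

Lemma Q_process_above r : I01 r -> S w < - K * Z r w ->
  Q r w = - S w / Z r w + 1.
Proof.
move=> Ir SZ; rewrite /Q /Q_process -/K -[K]opprK V_process_gt//; last exact: Z0.
by rewrite SZ (V_process_above S0 (Z0 Ir) K_le SZ).
Qed.

Lemma Q_process_below r : I01 r -> - K * Z r w <= S w -> Q r w = xi w + 1.
Proof.
move=> Ir SZ; rewrite /Q /Q_process -/K -[K]opprK V_process_gt//; last exact: Z0.
by rewrite ltNge SZ.
Qed.

(** When [S] differs from [- K * Z t], the strict inequality between them, which
    decides between the two branches of [Q], is the same at all times near [t]. *)
Lemma Q_process_cvg : S w <> - K * Z t w -> Q (s n) w @[n --> \oo] --> Q t w.
Proof.
move=> SnZ.
have KZs : - K * Z (s n) w @[n --> \oo] --> - K * Z t w by exact: cvgMr.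
have [SZ|SZ|//] := ltgtP (S w) (- K * Z t w).
- rewrite Q_process_above//.
  have Zt0 : Z t w != 0.
    by apply/eqP => Zt; move: SZ; rewrite Zt mulr0 ltNge ltW.
  apply: (@cvg_trans _ ((- S w / Z (s n) w + 1) @[n --> \oo])).
    apply: near_eq_cvg; near=> n; rewrite Q_process_above//.
    by near: n; exact: (cvgr_gt _ KZs).
  by apply: cvgD; [apply: cvgM; [exact: cvg_cst|exact: cvgV]|exact: cvg_cst].
- rewrite (Q_process_below It (ltW SZ)).
  apply: (@cvg_trans _ ((xi w + 1) @[n --> \oo])); last exact: cvg_cst.
  apply: near_eq_cvg; near=> n; rewrite Q_process_below//.
  by apply: ltW; near: n; exact: (cvgr_lt _ KZs).
Unshelve. all: by end_near. Qed.

Lemma Y_process_cvg : S w <> - K * Z t w -> U t w <> u ->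
  Y_process u U Q (s n) w @[n --> \oo] --> Y_process u U Q t w.
Proof.
move=> SnZ Unu; have Qs := Q_process_cvg SnZ.
under eq_fun do rewrite Y_processE; rewrite Y_processE.
have [uU|Uu|Uu] := ltgtP u (U t w); last by rewrite Uu in Unu.
- apply: (@cvg_trans _ ((u + (1 - u) * Q (s n) w) @[n --> \oo])).
    apply: near_eq_cvg; near=> n; rewrite ifT//.
    by near: n; exact: (cvgr_gt _ Us).
  by apply: cvgD; [exact: cvg_cst|apply: cvgM; [exact: cvg_cst|]].
- apply: (@cvg_trans _ (U (s n) w @[n --> \oo])) => //.
  apply: near_eq_cvg; near=> n; rewrite ifF//.
  by apply/negbTE; rewrite -leNgt ltW//; near: n; exact: (cvgr_lt _ Us).
Unshelve. all: by end_near. Qed.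

End pathwise.

(** * The spliced process *)

Section spliced_process.
Context {R : realType} {d : measure_display} {T : measurableType d}.
Variable P : probability T R.
Variables (U Z : R -> T -> R) (S xi : T -> R) (c M u : R).
Hypothesis U_copula : copula_process P U.
Hypothesis Z_gen : generator_process P c Z.
Hypothesis M_lt0 : M < 0.
Let K := K_const c M.
Hypothesis K_gtN1 : -1 < K.
Hypothesis S_unif : uniform_rv P ltr01 S.
Hypothesis S_indep_Z : independent P (sigma_rv S) (sigma_process Z).
Hypothesis xi_unif : uniform_rv P K_gtN1 xi.
Hypothesis xi_indep_V :
  independent P (sigma_rv xi) (sigma_process (V_process M S Z)).
Let Q := Q_process c M S xi Z.
Hypothesis Q_indep_U : independent P (sigma_process Q) (sigma_process U).
Hypothesis Z_indep_U : independent P (sigma_process Z) (sigma_process U).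
Hypotheses (u_gt0 : 0 < u) (u_lt1 : u < 1).
Let Y := Y_process u U Q.
Let Z' := thinned_generator U Z u.

Let u1_gt0 : 0 < 1 - u. Proof. by rewrite subr_gt0. Qed.

Let mQ t : I01 t -> measurable_fun setT (Q t).
Proof. by move=> It; exact: (measurable_Q_process Z_gen S_unif xi_unif It). Qed.

Let mU t : I01 t -> measurable_fun setT (U t).
Proof. by move=> It; have [] := U_copula It. Qed.

Let mQs : forall X, [set Q t | t in I01] X -> measurable_fun setT X.
Proof. by move=> _ [t It <-]; exact: mQ. Qed.

Let mZs : forall X, [set Z t | t in I01] X -> measurable_fun setT X.
Proof. by move=> _ [t It <-]; exact: measurable_generator Z_gen _ It. Qed.

Let mUs : forall X, [set U t | t in I01] X -> measurable_fun setT X.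
Proof. by move=> _ [t It <-]; exact: mU. Qed.

Lemma measurable_Y_process t : I01 t -> measurable_fun setT (Y t).
Proof.
move=> It; rewrite /Y (funext (Y_processE u U Q t)); apply: measurable_fun_ifT.
- by apply: measurable_fun_ltr => //; exact: mU.
- apply: measurable_funD => //; apply: measurable_funM => //; exact: mQ.
- exact: mU.
Qed.

(** Below [u] the distribution function is that of [U_t], since [Q_t > 0] almost
    surely; above [u] it is [u + (1 - u) * ((x - u) / (1 - u)) = x]. *)
Lemma Y_process_copula : copula_process P Y.
Proof.
move=> t It; have uU := U_copula It; have mY := measurable_Y_process It.
have uQ := Q_process_copula Z_gen M_lt0 S_unif S_indep_Z xi_unif xi_indep_V It.
have mUt := mU It; have mQt := mQ It.
apply: uniform01_cdf => // x /andP[x0 x1].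
have [xu|ux] := leP x u.
  transitivity (P [set w | U t w <= x]); last first.
    by rewrite (uniform_rv_le uU) ?x0// !subr0 divr1.
  apply: (probability_eq_ae (uniform_rv_negligible uQ)).
  - exact: measurable_le_fun.
  - exact: measurable_le_fun.
  - move=> w /contrapT/andP[Q0 _] /=; rewrite /Y Y_processE.
    have [uUw|//] := ltP u (U t w).
    have uY : u < u + (1 - u) * Q t w by rewrite ltrDl mulr_gt0.
    by split => H; exfalso; move: H; apply/negP; rewrite -ltNge;
      [exact: le_lt_trans uY|exact: le_lt_trans uUw].
have -> : [set w | Y t w <= x] = [set w | U t w <= u] `|`
    (Q t @^-1` `]-oo, (x - u) / (1 - u)] `&` U t @^-1` `]u, +oo[).
  apply/seteqP; split => w /=; rewrite !in_itv/= /Y Y_processE andbT.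
    have [uUw|] := ltP u (U t w); last by left.
    by right; rewrite ler_pdivlMr// mulrC lerBrDl.
  move=> [Uu|[+ ->]]; first by rewrite ltNge Uu/=; lra.
  by rewrite ler_pdivlMr// mulrC lerBrDl.
rewrite measureU//; last 3 first.
- exact: measurable_le_fun.
- apply: measurableI; rewrite -[X in measurable X]setTI; [exact: mQt|exact: mUt].
- apply/seteqP; split => w //= [+ [_]]; rewrite in_itv/= andbT.
  by rewrite ltNge => ->.
rewrite [X in (_ + X)%E]Q_indep_U; last 2 first.
- by apply: sigma_of_preimage => //; exists t.
- by apply: sigma_of_preimage => //; exists t.
rewrite [X in (X + _)%E](uniform_rv_le uU); last by rewrite !ltW.
have -> : P (U t @^-1` `]u, +oo[) = (1 - u)%:E.
  rewrite -(probability_U_gt U_copula u_gt0 u_lt1 It).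
  by congr (P _); apply/seteqP; split => w /=; rewrite in_itv/= andbT.
have -> : P (Q t @^-1` `]-oo, (x - u) / (1 - u)]) = ((x - u) / (1 - u))%:E.
  transitivity (P [set w | Q t w <= (x - u) / (1 - u)]).
    by congr (P _); apply/seteqP; split => w /=; rewrite in_itv.
  rewrite (uniform_rv_le uQ) ?subr0 ?divr1//.
  rewrite divr_ge0//= ?(ltW u1_gt0) ?subr_ge0 ?(ltW ux)//.
  by rewrite ler_pdivrMr// mul1r; lra.
rewrite -EFinM -EFinD divfK ?gt_eqF// !subr0 divr1; congr EFin; lra.
Qed.

Section exceedance_probability.
Variables (f : R -> R) (q : nat -> R).
Hypothesis q01 : forall k, I01 (q k).
Hypothesis f_small : forall k, `|f (q k)| <= (1 - u) * - K.

Let theta k w : R := `|f (q k)| * ((u < U (q k) w)%R%:R / (1 - u)).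

Lemma exceedance_level_bounds k w : 0 <= theta k w <= - K.
Proof.
have K0 : 0 < - K by rewrite oppr_gt0; exact: K_const_lt0 Z_gen M_lt0.
rewrite /theta; case: (u < U (q k) w) => /=; last by rewrite mul0r mulr0 lexx ltW.
rewrite mul1r divr_ge0 ?(ltW u1_gt0)//=.
by rewrite ler_pdivrMr// mulrC.
Qed.

Let measurable_theta k :
  measurable_fun [set: sigma_type [set U t | t in I01]] (theta k).
Proof. by apply: measurable_funM => //; exact: measurable_exceedance. Qed.

Lemma measurable_thinned_exceedance :
  measurable [set w | exists k, 1 - theta k w < Q (q k) w].
Proof.
rewrite (_ : [set w | _] = \bigcup_k [set w | 1 - theta k w < Q (q k) w]).
  apply: bigcupT_measurable => k; apply: measurable_lt_fun; last exact: mQ.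
  apply: measurable_funB => //.
  exact: (measurableT_comp (measurable_theta k) (measurable_to_sigma_type mUs)).
by apply/seteqP; split => w [k]; exists k.
Qed.

(** The indicator of [U > u] is absorbed into the level: where it vanishes the
    level is [1], which [Q] almost surely does not exceed.  Freezing [U] then
    leaves an event with constant levels, about [Q] alone. *)
Lemma probability_thinned_exceedance :
  P [set w | exists k, 1 - theta k w < Q (q k) w] =
  ('E_P[fun w => sup (range (fun k => (`|f (q k)| * Z' (q k) w)%R))])%E.
Proof.
pose E := [set z : sigma_type [set Q t | t in I01] * sigma_type [set U t | t in I01] |
  exists k, 1 - theta k z.2 < Q (q k) z.1].
have mE : measurable E.
  rewrite (_ : E = \bigcup_k [set z | 1 - theta k z.2 < Q (q k) z.1]); last first.
    by apply/seteqP; split => w [k]; exists k.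
  apply: bigcupT_measurable => k; apply: measurable_lt_fun.
    apply: measurable_funB => //.
    exact: (measurableT_comp (measurable_theta k)).
  have mQk : measurable_fun [set: sigma_type [set Q t | t in I01]] (Q (q k)).
    by apply: measurable_sigma_type; exists (q k).
  exact: (measurableT_comp mQk).
rewrite [LHS](independent_probability mQs mUs Q_indep_U mE).
pose h (z : sigma_type [set Z t | t in I01] * sigma_type [set U t | t in I01]) : R :=
  sup (range (fun k => theta k z.2 * Z (q k) z.1)).
have h01 k z : 0 <= theta k z.2 * Z (q k) z.1 <= 1.
  exact: (weighted_generator_le1 Z_gen _ (q01 k) (exceedance_level_bounds k _)).
have ubh z : has_ubound (range (fun k => theta k z.2 * Z (q k) z.1)).
  by exists 1 => _ [k _ <-]; have /andP[] := h01 k z.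
have mh : measurable_fun setT h.
  apply: measurable_sup_range => // k; apply: measurable_funM.
    exact: (measurableT_comp (measurable_theta k)).
  have mZk : measurable_fun [set: sigma_type [set Z t | t in I01]] (Z (q k)).
    by apply: measurable_sigma_type; exists (q k).
  exact: (measurableT_comp mZk).
(* the inner integral has [U] frozen at [w'] *)
transitivity (\int[P]_w' \int[P]_w (h (w, w'))%:E)%E.
  apply: eq_integral => w' _.
  rewrite [LHS](probability_Q_exceeds Z_gen S_unif S_indep_Z xi_unif q01
    (fun k => exceedance_level_bounds k w')).
  by rewrite unlock.
rewrite -(independent_integral mZs mUs Z_indep_U (h := EFin \o h)); last 2 first.
- exact/measurable_EFinP.
- move=> z; rewrite lee_fin (@le_trans _ _ (theta 0%N z.2 * Z (q 0%N) z.1))//.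
    by have /andP[] := h01 0%N z.
  by apply: ub_le_sup => //; exists 0%N.
rewrite unlock; apply: eq_integral => w _ /=; congr (sup _)%:E.
by apply: eq_imagel => k _; rewrite /theta /Z' /thinned_generator; ring.
Qed.

End exceedance_probability.

(** Where [U t w <= u] the level is [1] and both sides are false. *)
Lemma Q_process_thinned_gt t w a : I01 t -> ~ exceptional S xi c M w ->
  0 <= a <= (1 - u) * - K ->
  (1 - a * ((u < U t w)%R%:R / (1 - u)) < Q t w) = (S w < a * Z' t w).
Proof.
move=> It /not_exceptional[S0 xiK] /andP[a0 aK].
rewrite Q_process_gt//; last 2 first.
- exact: (generator_ge0 Z_gen _ It).
- case: (u < U t w) => /=; first by rewrite mul1r ler_pdivrMr// mulrC.
  by rewrite mul0r mulr0 oppr_ge0 ltW// (K_const_lt0 Z_gen M_lt0).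
by rewrite /Z' /thinned_generator -mulrA (mulrC (_ / _) (Z t w)).
Qed.

(** Where [U t w <= u] both sides are false, since [a <= 1 - u] keeps the level
    at or above [u].  Elsewhere [Y] is affine in [Q] with slope [1 - u], which the
    denominator of the thinned generator compensates. *)
Lemma Y_process_gt t w a : I01 t -> ~ exceptional S xi c M w ->
  0 <= a <= (1 - u) * - K -> (1 - a < Y t w) = (S w < a * Z' t w).
Proof.
move=> It ex /andP[a0 aK]; have [S0 xiK] := not_exceptional ex.
rewrite thinned_generator_gt ?ltW// /Y Y_processE.
have [uU|Uu] := ltP u (U t w) => /=; last first.
  (* [- K < 1] keeps the level above [u] *)
  apply/negbTE; rewrite -leNgt (le_trans Uu)//.
  have aK1 : a <= 1 - u.
    by apply: (le_trans aK); rewrite ler_piMr ?(ltW u1_gt0)// lerNl ltW.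
  by rewrite lerBrDr addrC -lerBrDr.
rewrite -ltr_pdivlMr// mulrAC -(Q_process_gt (c := c) (M := M) S0 _ xiK); last 2 first.
- exact: (generator_ge0 Z_gen _ It).
- by rewrite ler_pdivrMr// mulrC.
rewrite -ltrBlDl -ltr_pdivrMl//; congr (_ < _).
by field; rewrite gt_eqF.
Qed.

Hypotheses (U_cont : continuous_paths U) (Z_cont : continuous_paths Z).

(** The event is compared with the absence of exceedances of [Q] along the
    enumeration, which is measurable and differs from it by a null set. *)
Lemma Y_process_survival (f : R -> R) : E01_neg f ->
  sup_norm f <= (1 - u) * - K ->
  has_probability P [set w | forall t, I01 t -> Y t w <= 1 + f t]
    (1 - generated_norm P Z' f)%E.
Proof.
move=> [Ef f_le0] f_small.
have fE t : I01 t -> f t = - `|f t|.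
  by move=> It; rewrite ler0_norm ?f_le0// opprK.
have f_bnd t : I01 t -> 0 <= `|f t| <= (1 - u) * - K.
  move=> It; rewrite normr_ge0/=.
  exact: le_trans (sup_norm_le Ef.1 It) f_small.
have [q [q01 q_enum]] := exceedance_enumeration U_cont Z_cont u_lt1 Ef.
have mE := measurable_thinned_exceedance f q01.
exists (~` [set w | exists k,
  1 - `|f (q k)| * ((u < U (q k) w)%R%:R / (1 - u)) < Q (q k) w]); split.
- exact/measurableC/mE.
- apply: negligibleS (exceptional_negligible S_unif xi_unif) => w AB.
  apply: contrapT => ex; have [S0 _] := not_exceptional ex.
  suff E : (forall t, I01 t -> Y t w <= 1 + f t) <-> ~ (exists k,
      1 - `|f (q k)| * ((u < U (q k) w)%R%:R / (1 - u)) < Q (q k) w).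
    by case: AB => -[/= H1 H2]; apply: H2; exact/E.
  split=> [Yle [k]|nex t It].
    rewrite Q_process_thinned_gt ?f_bnd// -Y_process_gt ?f_bnd//.
    by rewrite -fE// ltNge Yle.
  rewrite leNgt fE// Y_process_gt ?f_bnd//.
  apply/negP => /(q_enum _ _ _ It (ltW S0))[k Sk].
  by apply: nex; exists k; rewrite Q_process_thinned_gt ?f_bnd.
- rewrite probability_setC; last exact: mE.
  have f_le k : `|f (q k)| <= (1 - u) * - K by case/andP: (f_bnd _ (q01 k)).
  rewrite [X in (_ - X)%E](probability_thinned_exceedance q01 f_le).
  rewrite /generated_norm; congr (_ - expectation _ _)%E.
  apply/funext => w; apply/esym.
  exact: (weighted_sup_enum Z_gen u_lt1 Ef.1 q01 q_enum).
Qed.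

Lemma Y_process_continuous_in_probability : continuous_in_probability P Y.
Proof.
move=> t s e It s01 st e0.
pose N := [set w | ~ (0 < S w < 1)] `|` [set w | S w = - K * Z t w] `|`
  [set w | U t w = u].
apply: (ae_cvg_in_probability (X := fun n => Y (s n)) (N := N)) => //.
- by move=> n; exact: measurable_Y_process.
- exact: measurable_Y_process.
- apply: negligibleU; first apply: negligibleU.
  + exact: uniform_rv_negligible S_unif.
  + apply/negligibleP.
      apply: measurable_eq_fun; first by case: S_unif.
      by apply: measurable_funM => //; apply: mZs; exists t.
    apply: (uniform_eq_indep S_unif mZs S_indep_Z (h := fun w => - K * Z t w)).
    by apply: measurable_funM => //; apply: measurable_sigma_type; exists t.
  + apply/negligibleP; first by apply: measurable_eq_fun => //; exact: mU.
    exact: uniform_rv_eq (U_copula It).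
- move=> w /not_orP[/not_orP[/contrapT/andP[S0 _] SnZ] Unu].
  have sI : s n @[n --> \oo] --> within I01 (nbhs t).
    by move=> W /st[m _ mW]; exists m => // n /mW /=; apply; exact: s01.
  apply: Y_process_cvg => //.
  + by move=> r Ir; exact: (generator_ge0 Z_gen _ Ir).
  + apply: (cvg_comp s (fun r => Z r w) sI).
    by have /subspace_continuousP := @Z_cont w; apply.
  + apply: (cvg_comp s (fun r => U r w) sI).
    by have /subspace_continuousP := @U_cont w; apply.
Qed.

End spliced_process.

(** * The theorem *)

Theorem theorem4p1 (R : realType) (d : measure_display) (T : measurableType d)
  (P : probability T R)
  (U Z : R -> T -> R) (S xi : T -> R) (c M u : R)
  (U_copula : copula_process P U) (U_cont : continuous_paths U)
  (Z_gen : generator_process P c Z) (Z_cont : continuous_paths Z)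
  (M_lt0 : M < 0) (K_gtN1 : -1 < K_const c M)
  (S_unif : uniform_rv P ltr01 S)
  (S_indep_Z : independent P (sigma_rv S) (sigma_process Z))
  (xi_unif : uniform_rv P K_gtN1 xi)
  (xi_indep_V :
    independent P (sigma_rv xi) (sigma_process (V_process M S Z)))
  (Q_indep_U :
    independent P (sigma_process (Q_process c M S xi Z)) (sigma_process U))
  (Z_indep_U : independent P (sigma_process Z) (sigma_process U))
  (u_gt0 : 0 < u) (u_lt1 : u < 1) :
  let Y := Y_process u U (Q_process c M S xi Z) in
  let Dnorm := fun f : R -> R =>
    ('E_P[fun w => sup [set `|f t| * Z t w * ((u < U t w)%R%:R / (1 - u))
                       | t in I01]%R])%E in
  GPCP P Dnorm Y /\ continuous_in_probability P Y.
Proof.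
move=> Y Dnorm.
have DnormE f : Dnorm f = generated_norm P (thinned_generator U Z u) f.
  rewrite /Dnorm /generated_norm; congr expectation; apply/funext => w.
  rewrite /weighted_sup; congr (sup _).
  by apply: eq_imagel => t _; rewrite -mulrA.
split; last first.
  move=> t s e; exact: (Y_process_continuous_in_probability _ U_copula Z_gen
    S_unif S_indep_Z xi_unif U_cont Z_cont).
split.
- exact: (Y_process_copula U_copula Z_gen M_lt0 S_unif S_indep_Z xi_unif
    xi_indep_V Q_indep_U).
- exists d, T, P, (c / (1 - u)), (thinned_generator U Z u); split.
    exact: thinned_generator_process.
  move=> f Ef; split=> //.
  have [q [q01 q_enum]] := exceedance_enumeration U_cont Z_cont u_lt1 Ef.
  exact: (measurable_weighted_sup U_copula Z_gen u_lt1 Ef.1 q01 q_enum).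
- exists ((1 - u) * - K_const c M).
    by rewrite mulr_gt0 ?subr_gt0// oppr_gt0 (K_const_lt0 Z_gen M_lt0).
  move=> f f_neg f_small; rewrite DnormE.
  exact: (Y_process_survival U_copula Z_gen M_lt0 S_unif S_indep_Z xi_unif
    Q_indep_U Z_indep_U u_lt1 U_cont Z_cont).
Qed.
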